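(* Let $(X,\sigma)$ be an open support for an extriangulated category $\mathcal{E}$ and let $x\in X$ be any point. If $X\setminus\overline{\{x\}}=\sigma(E)$ for some $E\in\mathcal{E}$, then $X\setminus\overline{\{x\}}\subseteq f_\sigma g_\sigma(X\setminus\overline{\{x\}})$ (so in fact $X\setminus\overline{\{x\}}=f_\sigma g_\sigma(X\setminus\overline{\{x\}})$). The converse holds if $X$ is Noetherian.
   Context: A support for $\mathcal{E}$ is a pair $(X,\sigma)$ with $X$ a topological space and $\sigma$ an assignment of a subset $\sigma(E)\subseteq X$ to each object $E$ such that $\sigma(0)=\emptyset$ and $\sigma(E\oplus F)=\sigma(E)\cup\sigma(F)$ (so $\sigma$ depends only on isomorphism classes); it is open if all $\sigma(E)$ are open in $X$. For a non-empty full subcategory $\mathcal{N}$ of $\mathcal{E}$ closed under finite direct sums and direct summands, $f_\sigma(\mathcal{N}):=\bigcup_{N\in\mathcal{N}}\sigma(N)$; for $S\subseteq X$, $g_\sigma(S):=\{E\in\mathcal{E}:\sigma(E)\subseteq S\}$. *)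

(* Defs.v *)
From mathcomp Require Import all_boot all_order all_algebra.
From mathcomp Require Import all_classical topology.
Set Implicit Arguments.
Unset Strict Implicit.
Unset Printing Implicit Defensive.
Import GRing.Theory.
Local Open Scope classical_set_scope.
Local Open Scope ring_scope.

Record preadditiveCategory := PreadditiveCategory {
  ob :> Type;
  hom : ob -> ob -> zmodType;
  idm : forall A, hom A A;
  compm : forall A B D, hom B D -> hom A B -> hom A D;
  comp1m : forall A B (f : hom A B), compm (idm B) f = f;
  compm1 : forall A B (f : hom A B), compm f (idm A) = f;
  compA : forall A B D F (h : hom D F) (g : hom B D) (f : hom A B),
    compm h (compm g f) = compm (compm h g) f;
  compDl : forall A B D (g g' : hom B D) (f : hom A B),
    compm (g + g') f = compm g f + compm g' f;
  compDr : forall A B D (g : hom B D) (f f' : hom A B),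
    compm g (f + f') = compm g f + compm g f' }.

Arguments idm {_} _.

Notation "g ∘ f" := (compm g f) (at level 40, left associativity).

Section PreadditiveTheory.
Variable C : preadditiveCategory.
Implicit Types A B D S Z : C.

Definition is_iso A B (f : hom A B) : Prop :=
  exists g : hom B A, g ∘ f = idm A /\ f ∘ g = idm B.

(* The zero morphism always exists, so initial and terminal amount to this. *)
Definition is_zero Z : Prop :=
  forall A, (forall f : hom Z A, f = 0) /\ (forall f : hom A Z, f = 0).

Record is_biproduct A B S (i1 : hom A S) (i2 : hom B S)
    (p1 : hom S A) (p2 : hom S B) : Prop := IsBiproduct {
  biprod11 : p1 ∘ i1 = idm A;
  biprod22 : p2 ∘ i2 = idm B;
  biprod12 : p1 ∘ i2 = 0;
  biprod21 : p2 ∘ i1 = 0;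
  biprod_id : i1 ∘ p1 + i2 ∘ p2 = idm S }.

(* Direct sums are never chosen: everything below is stated for all of them,
   hence is invariant under isomorphism. *)
Definition is_dsum A B S : Prop :=
  exists i1 i2 p1 p2, @is_biproduct A B S i1 i2 p1 p2.

End PreadditiveTheory.

Record additiveCategory := AdditiveCategory {
  precat :> preadditiveCategory;
  zero_ex : exists Z : precat, is_zero Z;
  dsum_ex : forall A B : precat, exists S, is_dsum A B S }.

(* An additive bifunctor C^op x C -> Ab.  [ext D A] is the group E(D, A) of
   extensions of D by A, [push a d] is a_* d and [pull c d] is c^* d. *)
Record extBifunctor (C : additiveCategory) := ExtBifunctor {
  ext : C -> C -> zmodType;
  push : forall (D A A' : C), hom A A' -> ext D A -> ext D A';
  pull : forall (D D' A : C), hom D' D -> ext D A -> ext D' A;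
  push1 : forall D A (d : ext D A), push (idm A) d = d;
  pushM : forall D A A' A'' (a' : hom A' A'') (a : hom A A') (d : ext D A),
    push (a' ∘ a) d = push a' (push a d);
  pull1 : forall D A (d : ext D A), pull (idm D) d = d;
  pullM : forall D D' D'' A (c : hom D' D) (c' : hom D'' D') (d : ext D A),
    pull (c ∘ c') d = pull c' (pull c d);
  push_pull : forall D D' A A' (a : hom A A') (c : hom D' D) (d : ext D A),
    push a (pull c d) = pull c (push a d);
  pushDr : forall D A A' (a : hom A A') (d d' : ext D A),
    push a (d + d') = push a d + push a d';
  pullDr : forall D D' A (c : hom D' D) (d d' : ext D A),
    pull c (d + d') = pull c d + pull c d';
  pushDl : forall D A A' (a a' : hom A A') (d : ext D A),
    push (a + a') d = push a d + push a' d;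
  pullDl : forall D D' A (c c' : hom D' D) (d : ext D A),
    pull (c + c') d = pull c d + pull c' d }.

(* Equivalence of sequences A -> B -> D and A -> B' -> D. *)
Definition seq_equiv (C : preadditiveCategory) (A D B B' : C)
    (x : hom A B) (y : hom B D) (x' : hom A B') (y' : hom B' D) : Prop :=
  exists b : hom B B', [/\ is_iso b, b ∘ x = x' & y' ∘ b = y].

(* The morphism f (+) f' between direct sums with projections p, p' at the
   source and injections j, j' at the target. *)
Definition dsum_map (C : preadditiveCategory) (A A' B B' S T : C)
    (p : hom S A) (p' : hom S A') (j : hom B T) (j' : hom B' T)
    (f : hom A B) (f' : hom A' B') : hom S T :=
  j ∘ f ∘ p + j' ∘ f' ∘ p'.

(* e is the extension d (+) d' in E(D (+) D', A (+) A'), i.e. the one with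
   components (d, 0, 0, d'); k, k' are the injections of D, D' and
   p, p' the projections onto A, A'. *)
Definition is_ext_dsum (C : additiveCategory) (E : extBifunctor C)
    (D D' A A' SD SA : C) (k : hom D SD) (k' : hom D' SD)
    (p : hom SA A) (p' : hom SA A')
    (d : ext E D A) (d' : ext E D' A') (e : ext E SD SA) : Prop :=
  [/\ push p (pull k e) = d, push p' (pull k e) = 0,
      push p (pull k' e) = 0 & push p' (pull k' e) = d'].

(* Extriangulated categories in the sense of Nakaoka and Palu, whose names the
   axioms keep.  [realizes d x y] means s(d) = [A -x-> B -y-> D].  The field [realizes_class]
   says that the sequences realizing d form exactly one equivalence class,
   i.e. that s is a map from extensions to equivalence classes. *)
Record extriangulatedCategory := ExtriangulatedCategory {
  addcat :> additiveCategory;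
  (* (ET1) *)
  Ext : extBifunctor addcat;
  realizes : forall D A B : addcat,
    ext Ext D A -> hom A B -> hom B D -> Prop;
  realizes_class : forall (D A : addcat) (d : ext Ext D A),
    exists (B : addcat) (x : hom A B) (y : hom B D),
      forall (B' : addcat) (x' : hom A B') (y' : hom B' D),
        realizes d x' y' <-> seq_equiv x y x' y';
  (* (ET2): s is a realization, and it is additive. *)
  realization : forall (D A B D' A' B' : addcat)
      (d : ext Ext D A) (x : hom A B) (y : hom B D)
      (d' : ext Ext D' A') (x' : hom A' B') (y' : hom B' D')
      (a : hom A A') (c : hom D D'),
    realizes d x y -> realizes d' x' y' -> push a d = pull c d' ->
    exists b : hom B B', b ∘ x = x' ∘ a /\ y' ∘ b = c ∘ y;
  realizes0 : forall (A D S : addcat) (i1 : hom A S) (i2 : hom D S)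
      (p1 : hom S A) (p2 : hom S D),
    is_biproduct i1 i2 p1 p2 -> realizes (0 : ext Ext D A) i1 p2;
  realizes_dsum : forall (D A B D' A' B' SD SA SB : addcat)
      (d : ext Ext D A) (x : hom A B) (y : hom B D)
      (d' : ext Ext D' A') (x' : hom A' B') (y' : hom B' D')
      (iA : hom A SA) (iA' : hom A' SA) (pA : hom SA A) (pA' : hom SA A')
      (iB : hom B SB) (iB' : hom B' SB) (pB : hom SB B) (pB' : hom SB B')
      (iD : hom D SD) (iD' : hom D' SD) (pD : hom SD D) (pD' : hom SD D')
      (e : ext Ext SD SA),
    realizes d x y -> realizes d' x' y' ->
    is_biproduct iA iA' pA pA' -> is_biproduct iB iB' pB pB' ->
    is_biproduct iD iD' pD pD' ->
    is_ext_dsum iD iD' pA pA' d d' e ->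
    realizes e (dsum_map pA pA' iB iB' x x') (dsum_map pB pB' iD iD' y y');
  (* (ET3) *)
  ET3 : forall (D A B D' A' B' : addcat)
      (d : ext Ext D A) (x : hom A B) (y : hom B D)
      (d' : ext Ext D' A') (x' : hom A' B') (y' : hom B' D')
      (a : hom A A') (b : hom B B'),
    realizes d x y -> realizes d' x' y' -> b ∘ x = x' ∘ a ->
    exists c : hom D D', push a d = pull c d' /\ c ∘ y = y' ∘ b;
  (* (ET3)^op *)
  ET3op : forall (D A B D' A' B' : addcat)
      (d : ext Ext D A) (x : hom A B) (y : hom B D)
      (d' : ext Ext D' A') (x' : hom A' B') (y' : hom B' D')
      (b : hom B B') (c : hom D D'),
    realizes d x y -> realizes d' x' y' -> c ∘ y = y' ∘ b ->
    exists a : hom A A', push a d = pull c d' /\ b ∘ x = x' ∘ a;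
  (* (ET4) : the diagram is
       A -f-> B -f'-> D
       |      |g      |u
       A -h-> K -h'-> G
              |g'     |v
              F   =   F        *)
  ET4 : forall (A B D K F : addcat)
      (d : ext Ext D A) (f : hom A B) (f' : hom B D)
      (d' : ext Ext F B) (g : hom B K) (g' : hom K F),
    realizes d f f' -> realizes d' g g' ->
    exists (G : addcat) (h : hom A K) (h' : hom K G) (u : hom D G)
           (v : hom G F) (d'' : ext Ext G A),
      [/\ h = g ∘ f, h' ∘ g = u ∘ f' & v ∘ h' = g'] /\
      [/\ realizes d'' h h', realizes (push f' d') u v,
          pull u d'' = d & push f d'' = pull v d'];
  (* (ET4)^op : the diagram is
       D -u-> G -v-> F
       |      |h'    |g'
       D -f'> A -f-> B
              |h     |g
              K   =  K         *)
  ET4op : forall (D A B F K : addcat)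
      (d : ext Ext B D) (f' : hom D A) (f : hom A B)
      (d' : ext Ext K F) (g' : hom F B) (g : hom B K),
    realizes d f' f -> realizes d' g' g ->
    exists (G : addcat) (u : hom D G) (v : hom G F) (h' : hom G A)
           (h : hom A K) (d'' : ext Ext K G),
      [/\ h = g ∘ f, h' ∘ u = f' & f ∘ h' = g' ∘ v] /\
      [/\ realizes d'' h' h, realizes (pull g' d) u v,
          push v d'' = d' & push u d = pull g d''] }.

Record objSupport (C : additiveCategory) (X : topologicalType) := ObjSupport {
  supp :> C -> set X;
  supp_zero : forall Z : C, is_zero Z -> supp Z = set0;
  supp_dsum : forall E F S : C, is_dsum E F S -> supp S = supp E `|` supp F }.

Definition open_support (C : additiveCategory) (X : topologicalType)
    (sigma : objSupport C X) : Prop :=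
  forall E : C, open (sigma E).

(* Non-empty full subcategories closed under finite direct sums and direct
   summands.  Zero objects (empty direct sums) belong to them, since they are
   summands of any object. *)
Record subcategory (C : additiveCategory) := Subcategory {
  subcat_ob :> set C;
  subcat_nonempty : subcat_ob !=set0;
  subcat_dsum : forall E F S : C, is_dsum E F S ->
    subcat_ob E -> subcat_ob F -> subcat_ob S;
  subcat_summand : forall E F S : C, is_dsum E F S ->
    subcat_ob S -> subcat_ob E }.

Definition f_supp (C : additiveCategory) (X : topologicalType)
    (sigma : objSupport C X) (N : subcategory C) : set X :=
  \bigcup_(E in N) sigma E.

Section GSupp.
Variables (C : additiveCategory) (X : topologicalType) (sigma : objSupport C X).
Variable S : set X.

Let g_ob : set C := [set E | sigma E `<=` S].

Fact g_supp_nonempty : g_ob !=set0.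
Proof.
by have [Z Z0] := zero_ex C; exists Z; rewrite /g_ob /= (supp_zero _ Z0).
Qed.

Fact g_supp_dsum (E F G : C) : is_dsum E F G -> g_ob E -> g_ob F -> g_ob G.
Proof.
by move=> EFG sE sF; rewrite /g_ob /= (supp_dsum _ EFG) subUset; split.
Qed.

Fact g_supp_summand (E F G : C) : is_dsum E F G -> g_ob G -> g_ob E.
Proof.
by move=> EFG; rewrite /g_ob /= (supp_dsum _ EFG) subUset => -[].
Qed.

Definition g_supp : subcategory C :=
  Subcategory g_supp_nonempty g_supp_dsum g_supp_summand.

End GSupp.

Definition noetherian_space (X : topologicalType) : Prop :=
  forall Z : nat -> set X, (forall n, closed (Z n)) ->
    (forall n, Z n.+1 `<=` Z n) ->
    exists N, forall n, (N <= n)%N -> Z n = Z N.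

(* Main.v *)
Require Import Defs.
From mathcomp Require Import all_boot all_order all_algebra.
From mathcomp Require Import all_classical topology.
Local Open Scope classical_set_scope.

(** Write U for the complement of the closure of x. If U = [sigma E], then [E] itself lies in
    [g_supp sigma U], so U is one term of the union; the other inclusion is formal
    ([f_supp_g_supp_sub]). Conversely, over a Noetherian space the union over any such subcategory
    is attained by a single object ([noetherian_f_supp]), here applied to [g_supp sigma U]. *)

Lemma f_supp_g_supp_sub (C : additiveCategory) (X : topologicalType)
    (sigma : objSupport C X) (S : set X) :
  f_supp sigma (g_supp sigma S) `<=` S.
Proof. exact: bigcup_sub. Qed.

(** Open sets satisfy the ascending chain condition, so some support is maximal; as direct sums
    realize unions, it contains all the others. *)
Lemma noetherian_f_supp (C : additiveCategory) (X : topologicalType)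
    (sigma : objSupport C X) (N : subcategory C) :
  open_support sigma -> noetherian_space X ->
  exists2 E : C, subcat_ob N E & f_supp sigma N = sigma E.
Proof.
move=> sigma_open noethX; apply: contrapT => noE.
(* The supports of the objects of N are directed by direct sums. *)
have bigger (E : C) : exists F : C, subcat_ob N E ->
    subcat_ob N F /\ sigma E `<` sigma F.
  (* Outside [N] any value will do: [bigger] is total so that [choice] yields a function on all
     objects. *)
  have [NE|nNE] := pselect (subcat_ob N E); last by exists E.
  have [F NF FE] : exists2 F, subcat_ob N F & ~ (sigma F `<=` sigma E).
    apply: contrapT => maxE; apply: noE; exists E => //; apply/seteqP; split.
      apply: bigcup_sub => F NF; apply: contrapT => FE.
      by apply: maxE; exists F.
    exact: bigcup_sup.
  have [S EFS] := dsum_ex E F; exists S => _; split.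
    exact: subcat_dsum EFS NE NF.
  rewrite (supp_dsum _ EFS); split; first exact: subsetUl.
  by rewrite subUset => -[_ /FE].
have [next nextP] := choice bigger; have [E0 NE0] := subcat_nonempty N.
pose E n := iter n next E0.
have NE n : subcat_ob N (E n) by elim: n => //= n /nextP[].
have ltE n : sigma (E n) `<` sigma (E n.+1) by have [] := nextP _ (NE n).
(* Complements of the increasing open supports form a decreasing chain of closed sets; its
   stabilization contradicts strictness at step [n]. *)
have [n stat] : exists n, forall m, (n <= m)%N -> ~` sigma (E m) = ~` sigma (E n).
  apply: noethX => n; first exact/open_closedC/sigma_open.
  by apply: subsetC; have [] := ltE n.
have := ltE n; rewrite -(setCK (sigma (E n.+1))) (stat _ (leqnSn n)) setCK.
by move=> [_]; apply.
Qed.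

Theorem lemma5p20 (C : extriangulatedCategory) (X : topologicalType)
    (sigma : objSupport C X) (sigma_open : open_support sigma) (x : X) :
  let U := ~` closure [set x] in
  ((exists E : C, U = sigma E) ->
     U `<=` f_supp sigma (g_supp sigma U) /\
     U = f_supp sigma (g_supp sigma U)) /\
  (noetherian_space X ->
     U `<=` f_supp sigma (g_supp sigma U) ->
     exists E : C, U = sigma E).
Proof.
move=> U; split=> [[E UE]|noethX subU].
  have subU : U `<=` f_supp sigma (g_supp sigma U).
    (* Only the left-hand [U] becomes [sigma E], leaving one term to include in the union. *)
    by rewrite {1}UE; apply: bigcup_sup; rewrite /= -UE.
  by split=> //; apply/seteqP; split=> //; exact: f_supp_g_supp_sub.
have [E _ fE] := noetherian_f_supp _ _ sigma (g_supp sigma U) sigma_open noethX.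
by exists E; rewrite -fE; apply/seteqP; split=> //; exact: f_supp_g_supp_sub.
Qed.
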